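(* Let $R$ be a finite chain ring of length $2$ with residue field $\mathbb{F}_q$. Then there exists a projective $(q^4-q^2-q,\,q^2-1)$-arc in $\mathrm{PHG}(2,R)$; equivalently, $\mathrm{m}_{q^2-1}(R)\geq q(q+1)(q^2-1)-q^3=q^4-q^2-q$.
   Context: Throughout, $R$ is a finite chain ring of nilpotency index (length) $2$, i.e. a finite local ring with radical $\mathrm{rad}R\neq 0$, $(\mathrm{rad}R)^2=0$, whose one-sided ideals form the chain $R\supsetneq\mathrm{rad}R\supsetneq 0$, with residue field $R/\mathrm{rad}R\cong\mathbb{F}_q$ ($q$ a prime power); then $|R|=q^2$. The projective Hjelmslev plane $\mathrm{PHG}(2,R)$ is the incidence structure whose points are the free rank-$1$ submodules of the right module $R_R^3$, whose lines are the free rank-$2$ submodules of $R_R^3$, with incidence given by inclusion; it has $q^4+q^3+q^2$ points and each line contains $q^2+q$ points. A $(k,n)$-arc is a map $\mathcal{K}$ from the point set to $\mathbb{N}_0$ with $\sum_x\mathcal{K}(x)=k$ and $\sum_{x\in L}\mathcal{K}(x)\le n$ for every line $L$; it is projective if $\mathcal{K}$ takes only values in $\{0,1\}$ (i.e. it is a set of $k$ points meeting every line in at most $n$ points). For $0\le n\le q^2+q$, $\mathrm{m}_n(R)$ denotes the largest $k$ such that a projective $(k,n)$-arc exists in $\mathrm{PHG}(2,R)$. *)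

(* Defs.v *)
From HB Require Import structures.
From mathcomp Require Import all_boot all_order all_algebra.
Set Implicit Arguments. Unset Strict Implicit. Unset Printing Implicit Defensive.
Import GRing.Theory.
Local Open Scope ring_scope.

Section Defs.
Variable R : finNzRingType.

Definition is_right_ideal (I : {set R}) : Prop :=
  0 \in I /\ (forall x y, x \in I -> y \in I -> x - y \in I)
  /\ (forall x r, x \in I -> x * r \in I).
Definition is_left_ideal (I : {set R}) : Prop :=
  0 \in I /\ (forall x y, x \in I -> y \in I -> x - y \in I)
  /\ (forall x r, x \in I -> r * x \in I).

(* R is a finite chain ring of nilpotency index 2 with radical N:
   N is a two-sided ideal, R <> N <> 0, N^2 = 0, and the only left ideals and
   the only right ideals of R are R, N and 0 (so N = rad R). *)
Definition chain_ring2 (N : {set R}) : Prop :=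
  [/\ is_right_ideal N /\ is_left_ideal N,
      N != [set 0] /\ N != [set: R],
      (forall x y, x \in N -> y \in N -> x * y = 0),
      (forall I, is_right_ideal I -> [\/ I = [set: R], I = N | I = [set 0]]) &
      (forall I, is_left_ideal I -> [\/ I = [set: R], I = N | I = [set 0]])].

Definition vec := 'rV[R]_3.
Definition rscale (x : vec) (r : R) : vec := \row_i (x ord0 i * r).

Definition is_point (P : {set vec}) : Prop :=
  exists x : vec, P = [set rscale x r | r : R] /\
    (forall r, rscale x r = 0 -> r = 0).

Definition is_line (L : {set vec}) : Prop :=
  exists x y : vec, L = [set rscale x r + rscale y s | r : R, s : R] /\
    (forall r s, rscale x r + rscale y s = 0 -> r = 0 /\ s = 0).

Definition proj_arc (K : {set {set vec}}) (k n : nat) : Prop :=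
  [/\ (forall P, P \in K -> is_point P), #|K| = k &
      forall L, is_line L -> (#|[set P in K | P \subset L]| <= n)%N].
End Defs.

(* Main.v *)
Require Import Defs.
From mathcomp Require Import all_boot all_order all_algebra.
From mathcomp Require Import zify.
Set Implicit Arguments. Unset Strict Implicit. Unset Printing Implicit Defensive.
Import GRing.Theory.

(* The complement of the arc must have q (q + 1)^2 points and meet every line
   in at least q + 1 points.  The multiset sum of q + 1 lines has this size and
   this property, but it repeats points; it is made into a set by moving points
   inside the neighbour classes.  On a class lying on m of the lines, counted
   with multiplicity, one takes m parallel line segments of q points each.  A
   line of PHG(2,R) meets them in m points if its direction in the class is
   different, and in 0 or q points if it is the same.

   If q = 2 or q >= 4, the lines are neighbours of the sides of the triangle
   X = 0, Y = 0, Z = 0, with multiplicities a, b, 1, where a + b = q; the class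
   of (0 : 0 : 1) is then removed completely, and the segments on the first two
   sides are chosen such that each line neighbouring such a side contains at
   least one of them (a "blocking family").
   If q = 3, four lines in general position are used, namely neighbours of
   X = 0, Y = 0, Z = 0, X + Y + Z = 0. *)

(** * Counting in finite sets, and the size of the triangle arc *)

Lemma set_interpolation (T : finType) (A B : {set T}) (k : nat) :
    A \subset B -> #|A| <= k <= #|B| ->
  exists C : {set T}, [/\ A \subset C, C \subset B & #|C| = k].
Proof.
move=> AB; elim: k => [|k IH] /andP[Ak kB].
  by exists A; split=> //; apply/eqP; rewrite -leqn0.
move: Ak; rewrite leq_eqVlt ltnS => /predU1P[<-|Ak]; first by exists A.
have [|C [AC CB Ck]] := IH; first by rewrite Ak ltnW.
have /set0Pn[x] : B :\: C != set0.
  by rewrite -card_gt0 cardsD (setIidPr CB) Ck subn_gt0.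
rewrite inE => /andP[xC xB]; exists (x |: C); split.
- exact: subset_trans AC (subsetUr _ _).
- by rewrite subUset sub1set xB.
- by rewrite cardsU1 xC Ck.
Qed.

Lemma card_sum_snd (S T : finType) (A : {set S * T}) :
  #|A| = \sum_y #|[set x | (x, y) \in A]|.
Proof.
rewrite -sum1_card (partition_big snd predT) //=; apply: eq_bigr => y _.
have inj : injective (fun x : S => (x, y)) by move=> x x' [].
rewrite sum1dep_card -(card_imset _ inj); apply: eq_card => -[x y'].
rewrite !inE /=; apply/andP/imsetP => [[xA /eqP <-]|[x']].
  by exists x; rewrite ?inE.
by rewrite inE => x'A [-> ->]; rewrite x'A eqxx.
Qed.

Lemma card_sum_fst (S T : finType) (A : {set S * T}) :
  #|A| = \sum_x #|[set y | (x, y) \in A]|.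
Proof.
rewrite -sum1_card (partition_big fst predT) //=; apply: eq_bigr => x _.
have inj : injective (fun y : T => (x, y)) by move=> y y' [].
rewrite sum1dep_card -(card_imset _ inj); apply: eq_card => -[x' y].
rewrite !inE /=; apply/andP/imsetP => [[yA /eqP <-]|[y']].
  by exists y; rewrite ?inE.
by rewrite inE => y'A [-> ->]; rewrite y'A eqxx.
Qed.

(** [x] and [y] are to be the sizes of two sets [unblocked], and the product that of the rest of the
    first chart. The hypotheses are additive because subtraction on [nat] is truncated; for the same
    reason [s] and [u] in the proof replace [q ^ 2 - q] and [q ^ 2 - 1]. *)
Lemma triangle_arc_size (q a b x y : nat) :
    1 < q -> a + b = q -> x + q ^ 2 * a + q = q ^ 3 ->
    y + q ^ 2 * b + q = q ^ 3 ->
  q ^ 4 - q ^ 2 - q = (q ^ 2 - q) * (q ^ 2 - 1) + x + y.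
Proof.
move=> q1 abq xE yE.
have xy : x + y + 2 * q = q ^ 3.
  have : q ^ 2 * a + q ^ 2 * b = q ^ 3 by rewrite -mulnDr abq -expnSr.
  by lia.
have q2 : q <= q ^ 2 by rewrite -mulnn leq_pmulr // ltnW.
have : (q ^ 2 - q) * (q ^ 2 - 1) + q ^ 3 + q ^ 2 = q ^ 4 + q.
  have [s sE] : exists s, q ^ 2 = s + q by exists (q ^ 2 - q); rewrite subnK.
  have [u uE] : exists u, q ^ 2 = u + 1.
    by exists (q ^ 2 - 1); rewrite subnK // (leq_trans _ q2) // ltnW.
  have q4 : q ^ 4 = (s + q) * (u + 1) by rewrite -sE -uE -expnD.
  have q3 : q ^ 3 = q * (u + 1) by rewrite -uE -expnS.
  rewrite {1}sE addnK {1}uE addnK q4 q3.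
  by rewrite mulnDl !mulnDr; lia.
by move: (_ * _) => w; lia.
Qed.

(** * Radical, units and cardinality of the chain ring *)

Section ChainRing.
Local Open Scope ring_scope.
Variables (R : finNzRingType) (N : {set R}).
Hypothesis chN : chain_ring2 N.

Lemma rad0 : 0 \in N.
Proof. by case: chN => [[[]]]. Qed.

Lemma radB x y : x \in N -> y \in N -> x - y \in N.
Proof. by case: chN => [[[_ [h _]] _] _ _ _ _]; apply: h. Qed.

Lemma radMr x r : x \in N -> x * r \in N.
Proof. by case: chN => [[[_ [_ h]] _] _ _ _ _]; apply: h. Qed.

Lemma radMl x r : x \in N -> r * x \in N.
Proof. by case: chN => [[_ [_ [_ h]]] _ _ _ _]; apply: h. Qed.

Lemma radN x : x \in N -> - x \in N.
Proof. by move=> Nx; rewrite -sub0r radB ?rad0. Qed.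

Lemma radD x y : x \in N -> y \in N -> x + y \in N.
Proof. by move=> Nx Ny; rewrite -[y]opprK radB ?radN. Qed.

Lemma radDl x y : x \in N -> (x + y \in N) = (y \in N).
Proof.
move=> Nx; apply/idP/idP => [h|]; last exact: radD.
by rewrite -[y](addKr x) radD ?radN.
Qed.

Lemma radDr x y : y \in N -> (x + y \in N) = (x \in N).
Proof. by move=> Ny; rewrite addrC radDl. Qed.

Lemma rad_mul0 x y : x \in N -> y \in N -> x * y = 0.
Proof. by case: chN => _ _ h _ _; apply: h. Qed.

Lemma one_notin_rad : 1 \notin N.
Proof.
case: chN => _ [_ /eqP NT] _ _ _; apply/negP => N1; apply: NT.
by apply/setP => x; rewrite inE -[x]mul1r radMr.
Qed.

Lemma principal_left_ideal (x : R) : is_left_ideal [set r * x | r : R].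
Proof.
split; first by apply/imsetP; exists 0; rewrite ?mul0r.
split=> [_ _ /imsetP[a _ ->] /imsetP[b _ ->]|_ s /imsetP[a _ ->]].
  by apply/imsetP; exists (a - b); rewrite ?mulrBl.
by apply/imsetP; exists (s * a); rewrite ?mulrA.
Qed.

Lemma principal_right_ideal (x : R) : is_right_ideal [set x * r | r : R].
Proof.
split; first by apply/imsetP; exists 0; rewrite ?mulr0.
split=> [_ _ /imsetP[a _ ->] /imsetP[b _ ->]|_ s /imsetP[a _ ->]].
  by apply/imsetP; exists (a - b); rewrite ?mulrBr.
by apply/imsetP; exists (a * s); rewrite ?mulrA.
Qed.

(** The left ideal generated by [x] contains [x], so it is neither [N] nor 0, and hence contains
    1. *)
Lemma linv_notin_rad x : x \notin N -> exists y, y * x = 1.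
Proof.
move=> xN; have xI : x \in [set r * x | r : R].
  by apply/imsetP; exists 1; rewrite ?mul1r.
case: chN => _ _ _ _ /(_ _ (principal_left_ideal x)) [] E.
- have : 1 \in [set r * x | r : R] by rewrite E inE.
  by case/imsetP=> y _ ->; exists y.
- by move: xI; rewrite E (negPf xN).
- by move: xI xN; rewrite E inE => /eqP->; rewrite rad0.
Qed.

Lemma rinv_notin_rad x : x \notin N -> exists y, x * y = 1.
Proof.
move=> xN; have xI : x \in [set x * r | r : R].
  by apply/imsetP; exists 1; rewrite ?mulr1.
case: chN => _ _ _ /(_ _ (principal_right_ideal x)) + _ => -[] E.
- have : 1 \in [set x * r | r : R] by rewrite E inE.
  by case/imsetP=> y _ ->; exists y.
- by move: xI; rewrite E (negPf xN).
- by move: xI xN; rewrite E inE => /eqP->; rewrite rad0.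
Qed.

Lemma mulr_notin_rad_inj d : d \notin N -> injective ( *%R d).
Proof.
case/linv_notin_rad=> y yd a b /(congr1 ( *%R y)) /=.
by rewrite !mulrA yd !mul1r.
Qed.

(** [N] is completely prime: if [a * x = 1] and [y * b = 1], then [x * y] in [N] would put
    [a * (x * y) * b = 1] in [N]. *)
Lemma radM x y : (x * y \in N) = (x \in N) || (y \in N).
Proof.
case: (boolP (x \in N)) => [/radMr->//|xN].
case: (boolP (y \in N)) => [/radMl->//|yN].
have [a ax] := linv_notin_rad xN; have [b yb] := rinv_notin_rad yN.
apply/negP => /(radMl a) /(radMr b); rewrite mulrA ax mul1r yb.
exact/negP/one_notin_rad.
Qed.

Lemma rad_nonzero : exists2 t, t \in N & t != 0.
Proof.
case: chN => _ [N0 _] _ _ _.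
have: [exists t in N, t != 0].
  apply: contraR N0; rewrite negb_exists => /forallP h.
  apply/eqP/setP => t; rewrite inE; apply/idP/eqP => [tN|->]; last exact: rad0.
  by apply/eqP; move: (h t); rewrite tN negbK.
by case/existsP=> t /andP[]; exists t.
Qed.

Section Uniformizer.
Variable t : R.
Hypotheses (tN : t \in N) (t0 : t != 0).

Lemma mulr_unif_eq0 r : (r * t == 0) = (r \in N).
Proof.
apply/idP/idP => [/eqP rt|rN]; last by rewrite rad_mul0.
apply: contraR t0 => /linv_notin_rad[y yr].
by rewrite -[t]mul1r -yr -mulrA rt mulr0.
Qed.

Lemma mull_unif_eq0 r : (t * r == 0) = (r \in N).
Proof.
apply/idP/idP => [/eqP rt|rN]; last by rewrite rad_mul0.
apply: contraR t0 => /rinv_notin_rad[y ry].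
by rewrite -[t]mulr1 -ry mulrA rt mul0r.
Qed.

(** The left ideal generated by [t] is not 0, so it is [R] or [N], and both contain [n]. *)
Lemma rad_lgen n : n \in N -> exists r, n = r * t.
Proof.
case: chN => _ _ _ _ /(_ _ (principal_left_ideal t)) h nN.
have tI : t \in [set r * t | r : R] by apply/imsetP; exists 1; rewrite ?mul1r.
suff: n \in [set r * t | r : R] by case/imsetP=> r _ ->; exists r.
case: h => E; rewrite E //.
by move: tI; rewrite E inE (negPf t0).
Qed.

Lemma rad_rgen n : n \in N -> exists r, n = t * r.
Proof.
case: chN => _ _ _ /(_ _ (principal_right_ideal t)) + _ => h nN.
have tI : t \in [set t * r | r : R] by apply/imsetP; exists 1; rewrite ?mulr1.
suff: n \in [set t * r | r : R] by case/imsetP=> r _ ->; exists r.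
case: h => E; rewrite E //.
by move: tI; rewrite E inE (negPf t0).
Qed.

End Uniformizer.

(** Right multiplication by a nonzero [t] in [N] maps [R] onto [N], and its fibres are the cosets of
    its kernel [N]. *)
Lemma card_chain_ring : #|R| = (#|N| * #|N|)%N.
Proof.
have [t tN t0] := rad_nonzero.
rewrite -[LHS]sum1_card (partition_big ( *%R^~ t) (mem N)) /=; last first.
  by move=> r _; exact: radMl.
transitivity (\sum_(n in N) #|N|)%N; last by rewrite sum_nat_const.
apply: eq_bigr => n /(rad_lgen t0)[r ->].
rewrite sum1dep_card -(card_imset (mem N) (@addrI _ r)).
apply: eq_card => s; rewrite inE /=; apply/idP/imsetP => [|[m mN ->]].
  rewrite -subr_eq0 -mulrBl mulr_unif_eq0 // => srN.
  by exists (s - r); rewrite // addrC subrK.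
by rewrite mulrDl (rad_mul0 mN tN) addr0.
Qed.

Lemma card_rad_gt1 : (1 < #|N|)%N.
Proof.
have [t tN t0] := rad_nonzero; rewrite (cardsD1 0) rad0 add1n ltnS card_gt0.
by apply/set0Pn; exists t; rewrite !inE t0.
Qed.

(** * Equations of lines *)

(** The cases are whether the projection [g] of the line to the coordinates [i], [j] is injective.
    If so, it is bijective by finiteness, and coordinate [k] is a function of these two. If not, a
    nonzero vector of its kernel yields [v]. *)
Lemma line_coordinate (L : {set vec R}) (i j k : 'I_3) :
    (forall l, [|| l == i, l == j | l == k]) -> is_line L ->
  (exists2 v, v \in L & [/\ v 0 i \in N, v 0 j \in N & v 0 k = 1]) \/
  (exists c d, forall v, v \in L -> v 0 k = c * v 0 i + d * v 0 j).
Proof.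
move=> ijk [x [y [-> free]]].
pose f r s l := x 0 l * r + y 0 l * s.
have fE r s l : (rscale x r + rscale y s) 0 l = f r s l by rewrite !mxE.
have fM r s u l : f (r * u) (s * u) l = f r s l * u.
  by rewrite /f mulrDl !mulrA.
have fD r s r' s' l : f (r + r') (s + s') l = f r s l + f r' s' l.
  by rewrite /f !mulrDr addrACA.
have f0 r s : f r s i = 0 -> f r s j = 0 -> f r s k = 0 -> r = 0 /\ s = 0.
  move=> fi fj fk; apply: free; apply/rowP => l; rewrite fE mxE.
  by case/or3P: (ijk l) => /eqP->.
pose g (p : R * R) := (f p.1 p.2 i, f p.1 p.2 j).
have [/injectiveP g_inj|/injectivePn[p [p' pp' gE]]] := boolP (injectiveb g).
  right; have [h _ hK] := injF_bij g_inj.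
  have [gi1 gj1] : g (h (1, 0)) = (1, 0) by rewrite hK.
  have [gi2 gj2] : g (h (0, 1)) = (0, 1) by rewrite hK.
  set a := h (1, 0) in gi1 gj1; set b := h (0, 1) in gi2 gj2.
  exists (f a.1 a.2 k), (f b.1 b.2 k) => _ /imset2P[r s _ _ ->]; rewrite !fE.
  suff E : (r, s) = (a.1 * f r s i + b.1 * f r s j,
                    a.2 * f r s i + b.2 * f r s j).
    by have /= -> := congr1 (fun p => f p.1 p.2 k) E; rewrite fD !fM.
  apply: g_inj; rewrite /g /= !fD !fM gi1 gi2 gj1 gj2.
  by rewrite !(mul1r, mul0r, add0r, addr0).
left; have [t tN t0] := rad_nonzero.
suff [a [b [fi fj /rinv_notin_rad[u ku]]]] :
    exists a b, [/\ f a b i \in N, f a b j \in N & f a b k \notin N].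
  exists (rscale x (a * u) + rscale y (b * u)); first exact: imset2_f.
  by rewrite !fE !fM ku !radMr.
pose a := p.1 - p'.1; pose b := p.2 - p'.2.
have fB l : f a b l = f p.1 p.2 l - f p'.1 p'.2 l.
  by rewrite /f !mulrBr opprD addrACA.
case: gE => fi fj.
have {fi} fi : f a b i = 0 by rewrite fB fi subrr.
have {fj} fj : f a b j = 0 by rewrite fB fj subrr.
have fk : f a b k != 0.
  apply: contra pp' => /eqP /(f0 _ _ fi fj) [/eqP + /eqP].
  by rewrite !subr_eq0 => ? ?; rewrite -pair_eqE /pair_eq; apply/andP.
(* If entry [k] is in [N] as well, [t] kills the whole vector. By freeness [a * t = b * t = 0], so
   [a] and [b] are left multiples of [t]; cancelling [t] gives a vector with entry [k] outside [N]
   and the other two in [N]. *)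
have [fkN|fkN] := boolP (f a b k \in N); last first.
  by exists a, b; rewrite fi fj rad0.
have [] : a * t = 0 /\ b * t = 0.
  by apply: f0; rewrite fM ?fi ?fj ?mul0r // (rad_mul0 fkN tN).
move/eqP; rewrite (mulr_unif_eq0 tN t0) => /(rad_lgen t0)[a' aE].
move/eqP; rewrite (mulr_unif_eq0 tN t0) => /(rad_lgen t0)[b' bE].
exists a', b'; rewrite -!(mulr_unif_eq0 tN t0) -!fM -aE -bE.
by rewrite fi fj eqxx.
Qed.

(** Products in [N] vanish, so combining the [w k] with a triple of coefficients in [N] gives back
    that triple as a vector. Its coefficients in the basis [x], [y] are in [N] too, so triples over
    [N] would embed into pairs over [N]. *)
Lemma line_not_spanning (L : {set vec R}) (w : 'I_3 -> vec R) :
    is_line L -> (forall k, w k \in L) ->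
  ~ (forall k l, if l == k then w k 0 l = 1 else w k 0 l \in N).
Proof.
move=> [x [y [-> free]]] wL wE.
have /fin_all_exists[ab abE] k : exists p : R * R,
    w k = rscale x p.1 + rscale y p.2.
  by case/imset2P: (wL k) => r s _ _ ->; exists (r, s).
pose h (n : R * R * R) (g : R * R -> R) :=
  g (ab 0) * n.1.1 + g (ab 1) * n.1.2 + g (ab 2) * n.2.
pose f n := (h n fst, h n snd).
pose N3 := setX (setX N N) N.
have f_inj : {in N3 &, injective f}.
  suff coordE n : n \in N3 ->
      (n.1.1, n.1.2, n.2) = let c l := x 0 l * (f n).1 + y 0 l * (f n).2 in
                            (c 0, c 1, c 2).
    move=> n n' /coordE nE /coordE n'E E; move: nE; rewrite E -n'E.
    by case: n n' {n'E E} => [[a b] c] [[a' b'] c'].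
  case: n => [[a b] c]; rewrite !inE /= => /andP[/andP[aN bN] cN].
  have cE l : x 0 l * h (a, b, c) fst + y 0 l * h (a, b, c) snd =
      w 0 0 l * a + w 1 0 l * b + w 2 0 l * c.
    rewrite /h /= !abE !mxE !mulrDl !mulrDr !mulrA -!addrA.
    by rewrite [X in _ = _ + X]addrCA; do 2!congr (_ + _); rewrite addrCA;
       congr (_ + _); rewrite addrCA.
  rewrite !cE.
  have w0 k l m : l != k -> m \in N -> w k 0 l * m = 0.
    move=> lk mN; move: (wE k l); rewrite (negPf lk) => wN.
    exact: rad_mul0.
  have w1 k : w k 0 k = 1 by move: (wE k k); rewrite eqxx.
  by rewrite !w1 !w0 // !mul1r !(addr0, add0r).
have: (#|f @: N3| <= #|setX N N|)%N.
  apply/subset_leq_card/subsetP => _ /imsetP[n + ->].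
  rewrite !inE => /andP[/andP[? ?] ?].
  by rewrite /f /h /= !radD ?radMl.
rewrite (card_in_imset f_inj) !cardsX.
by have := card_rad_gt1; nia.
Qed.

(** Coordinate 2 is solved for if possible, otherwise coordinate 1, otherwise 0. Each failure
    supplies a vector of the line congruent to a unit vector modulo [N]; substituting it in the
    later equations puts coefficients in [N]. A third failure contradicts [line_not_spanning]. *)
Lemma line_equation (L : {set vec R}) : is_line L ->
  [\/ exists c d, forall v, v \in L -> v 0 2 = c * v 0 0 + d * v 0 1,
      exists c e, e \in N /\ forall v, v \in L -> v 0 1 = c * v 0 0 + e * v 0 2
    | exists c e, [/\ c \in N, e \in N &
                      forall v, v \in L -> v 0 0 = c * v 0 1 + e * v 0 2]].
Proof.
move=> lineL.
have cov012 (l : 'I_3) : [|| l == 0, l == 1 | l == 2] by case: l => [[|[|[]]]].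
have cov021 (l : 'I_3) : [|| l == 0, l == 2 | l == 1] by case: l => [[|[|[]]]].
have cov120 (l : 'I_3) : [|| l == 1, l == 2 | l == 0] by case: l => [[|[|[]]]].
have [[w2 w2L [w20 w21 w22]]|] := line_coordinate cov012 lineL;
  last by constructor 1.
have [[w1 w1L [w10 w12 w11]]|[c [e h]]] := line_coordinate cov021 lineL; last first.
  constructor 2; exists c, e; split=> //.
  by move: w21; rewrite (h _ w2L) w22 mulr1 radDl ?radMl.
have [[w0 w0L [w01 w02 w00]]|[c [e h]]] := line_coordinate cov120 lineL.
  case: (@line_not_spanning L (fun k => [:: w0; w1; w2]`_k) lineL).
    by case=> [[|[|[|]]]].
  move=> k l; case/or3P: (cov012 k) => /eqP->;
    by case/or3P: (cov012 l) => /eqP->.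
constructor 3; exists c, e.
have eN : e \in N by move: w20; rewrite (h _ w2L) w22 mulr1 radDl ?radMl.
by split=> //; move: w10; rewrite (h _ w1L) w11 mulr1 radDr ?radMr.
Qed.

(** * Normalized coordinates and charts *)

Definition vec3 (a b c : R) : vec R := \row_i [:: a; b; c]`_i.

Lemma vec3_0 a b c : vec3 a b c 0 0 = a. Proof. by rewrite mxE. Qed.
Lemma vec3_1 a b c : vec3 a b c 0 1 = b. Proof. by rewrite mxE. Qed.
Lemma vec3_2 a b c : vec3 a b c 0 2 = c. Proof. by rewrite mxE. Qed.
Definition vec3E := (vec3_0, vec3_1, vec3_2).

Lemma vec3_inj a b c a' b' c' :
  vec3 a b c = vec3 a' b' c' -> [/\ a = a', b = b' & c = c'].
Proof.
move=> E; have h l := congr1 (fun v : vec R => v 0 l) E.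
by move: (h 0) (h 1) (h 2); rewrite !vec3E.
Qed.

Definition span (v : vec R) : {set vec R} := [set rscale v r | r : R].

Lemma mem_span v : v \in span v.
Proof.
by apply/imsetP; exists 1 => //; apply/rowP => i; rewrite mxE mulr1.
Qed.

Definition normalized (v : vec R) :=
  [\/ v 0 0 = 1, v 0 0 \in N /\ v 0 1 = 1
    | [/\ v 0 0 \in N, v 0 1 \in N & v 0 2 = 1]].

Lemma span_normalized_point v : normalized v -> is_point (span v).
Proof.
move=> nv; exists v; split=> // r /rowP E.
have E' l : v 0 l * r = 0 by have := E l; rewrite !mxE.
case: nv => [v0|[_ v1]|[_ _ v2]].
- by have := E' 0; rewrite v0 mul1r.
- by have := E' 1; rewrite v1 mul1r.
- by have := E' 2; rewrite v2 mul1r.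
Qed.

(** In [v = rscale w r] the entry 1 of [v] forces [r] outside [N]. Hence [v] and [w] have their
    first entry outside [N] in the same place; it is 1 in both, so [r = 1]. *)
Lemma span_normalized_inj v w :
  normalized v -> normalized w -> span v = span w -> v = w.
Proof.
move=> nv nw E; have := mem_span v; rewrite E => /imsetP[r _ vE].
have {E} vE l : v 0 l = w 0 l * r by rewrite vE mxE.
suff r1 : r = 1 by apply/rowP => l; rewrite vE r1 mulr1.
have N1 := negPf one_notin_rad.
have unitr l : v 0 l = 1 -> (w 0 l \in N) = false /\ (r \in N) = false.
  by move=> vl; move: N1; rewrite -vl vE radM; do 2!case: (_ \in N).
have radw l : (r \in N) = false -> v 0 l \in N -> w 0 l \in N.
  by move=> rN; rewrite vE radM rN orbF.
case: nv => [v0|[v0 v1]|[v0 v1 v2]].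
- have [w0N rN] := unitr _ v0; move: (v0); rewrite vE.
  by case: nw => [->|[]|[]]; rewrite ?w0N // mul1r.
- have [w1N rN] := unitr _ v1; have w0 := radw _ rN v0.
  move: (v1); rewrite vE; case: nw => [w01|[_ ->]|[_]].
  + by rewrite w01 N1 in w0.
  + by rewrite mul1r.
  + by rewrite w1N.
- have [w2N rN] := unitr _ v2.
  have w0 := radw _ rN v0; have w1 := radw _ rN v1.
  move: (v2); rewrite vE; case: nw => [w01|[_ w11]|[_ _ ->]].
  + by rewrite w01 N1 in w0.
  + by rewrite w11 N1 in w1.
  + by rewrite mul1r.
Qed.

Lemma card_graph_le (A B : {set R * R}) (f : R -> R) :
    (forall p, p \in B -> p \in A /\ p.2 = f p.1) ->
  (#|B| <= #|[set x | (x, f x) \in A]|)%N.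
Proof.
move=> h; have inj : {in B &, injective fst}.
  move=> [a b] [a' b'] /h [_ /= ->] /h [_ /= ->] -> //.
rewrite -(card_in_imset inj); apply/subset_leq_card/subsetP.
by move=> _ /imsetP[[a b] /h [pA /= bE] ->]; rewrite inE -bE.
Qed.

Lemma card_cograph_le (A B : {set R * R}) (f : R -> R) :
    (forall p, p \in B -> p \in A /\ p.1 = f p.2) ->
  (#|B| <= #|[set x | (f x, x) \in A]|)%N.
Proof.
move=> h; have inj : {in B &, injective snd}.
  move=> [a b] [a' b'] /h [_ /= ->] /h [_ /= ->] -> //.
rewrite -(card_in_imset inj); apply/subset_leq_card/subsetP.
by move=> _ /imsetP[[a b] /h [pA /= bE] ->]; rewrite inE -bE.
Qed.

(* Every point has a unique representative (1, y, z), (x, 1, z) with x in N,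
   or (x, y, 1) with x and y in N; A1, A2, A3 collect the free coordinates. *)
Lemma proj_arc_of_charts (A1 A2 A3 : {set R * R}) (n : nat) :
    (forall p, p \in A2 -> p.1 \in N) ->
    (forall p, p \in A3 -> p.1 \in N /\ p.2 \in N) ->
    (forall c d : R, #|[set y | (y, c + d * y)%R \in A1]| +
                 #|[set x | (x, c * x + d)%R \in A2]| <= n)%N ->
    (forall c e : R, e \in N ->
       #|[set z | (c + e * z, z)%R \in A1]| +
       #|[set x | (x, c * x + e)%R \in A3]| <= n)%N ->
    (forall c e : R, c \in N -> e \in N ->
       #|[set z | (c + e * z, z)%R \in A2]| +
       #|[set y | (c * y + e, y)%R \in A3]| <= n)%N ->
  exists K : {set {set vec R}}, proj_arc K (#|A1| + #|A2| + #|A3|) n.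
Proof.
move=> A2N A3N line1 line2 line3.
pose c1 (p : R * R) := vec3 1 p.1 p.2.
pose c2 (p : R * R) := vec3 p.1 1 p.2.
pose c3 (p : R * R) := vec3 p.1 p.2 1.
have N1 := negPf one_notin_rad.
have c1_inj : injective c1 by move=> [a b] [a' b'] /vec3_inj [_ /= -> ->].
have c2_inj : injective c2 by move=> [a b] [a' b'] /vec3_inj [/= -> _ ->].
have c3_inj : injective c3 by move=> [a b] [a' b'] /vec3_inj [/= -> ->].
pose V := c1 @: A1 :|: c2 @: A2 :|: c3 @: A3.
have normV v : v \in V -> normalized v.
  rewrite !inE -orbA => /or3P[] /imsetP[p pA ->].
  - by constructor 1; rewrite vec3E.
  - by constructor 2; rewrite !vec3E; split=> //; apply: A2N.
  - by constructor 3; have [? ?] := A3N _ pA; rewrite !vec3E.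
have span_inj : {in V &, injective span}.
  by move=> v w /normV nv /normV nw; apply: span_normalized_inj.
have cardV : #|V| = (#|A1| + #|A2| + #|A3|)%N.
  rewrite -(card_imset A1 c1_inj) -(card_imset A2 c2_inj).
  rewrite -(card_imset A3 c3_inj) !cardsU.
  have -> : c1 @: A1 :&: c2 @: A2 = set0.
    apply/setP => v; rewrite !inE; apply/negP.
    case/andP=> /imsetP[p _ ->] /imsetP[p' /A2N p'N /vec3_inj[E _ _]].
    by rewrite -E N1 in p'N.
  have -> : (c1 @: A1 :|: c2 @: A2) :&: c3 @: A3 = set0.
    apply/setP => v; rewrite !inE; apply/negP.
    case/andP=> vA /imsetP[p' /A3N[p1 p2] vE]; move: vA; rewrite {}vE.
    case/orP=> /imsetP[p _ /vec3_inj[E1 E2 _]]; first by rewrite E1 N1 in p1.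
    by rewrite E2 N1 in p2.
  by rewrite !cards0 !subn0.
exists (span @: V); split.
- by move=> P /imsetP[v /normV nv ->]; apply: span_normalized_point.
- by rewrite card_in_imset.
move=> L lineL.
pose on c (A : {set R * R}) := [set p in A | c p \in L].
suff: (#|on c1 A1| + #|on c2 A2| + #|on c3 A3| <= n)%N.
  apply: leq_trans.
  have le_card c (A : {set R * R}) : (#|c @: A :&: L| <= #|on c A|)%N.
    apply: leq_trans (leq_imset_card c _).
    apply/subset_leq_card/subsetP=> v; rewrite inE => /andP[/imsetP[p pA ->] pL].
    by apply: imset_f; rewrite inE pA.
  apply: leq_trans (leq_add (leq_add (le_card _ _) (le_card _ _)) (le_card _ _)).
  apply: (@leq_trans #|V :&: L|).
    apply: leq_trans (leq_imset_card span _).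
    apply/subset_leq_card/subsetP=> P.
    rewrite inE => /andP[/imsetP[v vV ->] vL]; apply: imset_f.
    by rewrite inE vV (subsetP vL) ?mem_span.
  rewrite /V !setIUl; apply: leq_trans (leq_card_setU _ _) _.
  by rewrite leq_add2r leq_card_setU.
have on0 c (A : {set R * R}) : (forall p, p \in A -> c p \in L -> False) -> #|on c A| = 0%N.
  move=> h; apply/eqP; rewrite cards_eq0; apply/eqP/setP => p; rewrite !inE.
  by apply/negP => /andP[/h].
have onP c (A : {set R * R}) p : p \in on c A -> p \in A /\ c p \in L by rewrite inE => /andP.
(* Each type of line misses one chart, where its equation would put 1 in [N]. *)
case: (line_equation lineL) => [[c [d eqL]]|[c [e [eN eqL]]]|[c [e [cN eN eqL]]]].
- rewrite (on0 c3) => [|p /A3N[p1 p2] /eqL]; last first.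
    by rewrite !vec3E => E; move: N1; rewrite E radD ?radMl.
  rewrite addn0; apply: leq_trans (line1 c d); apply: leq_add.
  + apply: card_graph_le => p /onP[pA /eqL].
    by rewrite !vec3E mulr1.
  + apply: card_graph_le => p /onP[pA /eqL].
    by rewrite !vec3E mulr1.
- rewrite (on0 c2) => [|p /A2N p1 /eqL]; last first.
    by rewrite !vec3E => E; move: N1; rewrite E radD // radM ?p1 ?eN ?orbT.
  rewrite addn0; apply: leq_trans (line2 c e eN); apply: leq_add.
  + apply: card_cograph_le => p /onP[pA /eqL].
    by rewrite !vec3E mulr1.
  + apply: card_graph_le => p /onP[pA /eqL].
    by rewrite !vec3E mulr1.
- rewrite (on0 c1) => [|p pA /eqL]; last first.
    by rewrite !vec3E => E; move: N1; rewrite E radD ?radMr.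
  rewrite add0n; apply: leq_trans (line3 c e cN eN); apply: leq_add.
  + apply: card_cograph_le => p /onP[pA /eqL].
    by rewrite !vec3E mulr1.
  + apply: card_cograph_le => p /onP[pA /eqL].
    by rewrite !vec3E mulr1.
Qed.

(** * The arc from a triangle *)

Section Triangle.
Variable t : R.
Hypotheses (tN : t \in N) (t0 : t != 0).

(* [z |-> E (t * z)] is a family of sets indexed by R / N; the last condition
   says that it meets every affine function [z |-> n + m * z] from R / N to N. *)
Definition blocking_family (k : nat) (E : R -> {set R}) :=
  [/\ forall x, E x \subset N,
      forall x, x \in N -> #|E x| = (k + (x == 0)%R)%N &
      forall n m, n \in N -> m \in N -> exists z, n + m * z \in E (t * z)].

(** If [1 < k], each [E x] with [x] in [N] is chosen to contain 0 and [x]: a constant function [n]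
    is met where [t * z = n], and one with slope [m != 0] where it vanishes, as [m] generates [N].
    If [k = 1] and [N] has two elements, [E 0 = N] meets every function at [z = 0]. *)
Lemma blocking_family_exists k :
    (1 < k < #|N|)%N \/ (k = 1%N /\ #|N| = 2%N) ->
  exists E, blocking_family k E.
Proof.
have cardle2 (x : R) : (#|[set 0%R; x]| <= 2)%N.
  by rewrite cards2; case: (_ != _).
case=> [/andP[k1 kN]|[-> N2]].
  have /fin_all_exists[E hE] (x : R) : exists E : {set R}, x \in N ->
      [/\ [set 0; x] \subset E, E \subset N & #|E| = (k + (x == 0)%R)%N].
    have [xN|xN] := boolP (x \in N); last by exists set0.
    have sub : [set 0; x] \subset N by rewrite subUset !sub1set rad0 xN.
    have [|C hC] := @set_interpolation _ _ _ (k + (x == 0)%R) sub; last by exists C.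
    apply/andP; split; first by apply: leq_trans (cardle2 x) _; lia.
    by case: (x == 0); rewrite /= ?addn1 ?addn0 ?(ltnW kN).
  exists (fun x => if x \in N then E x else set0); split.
  - by move=> x; case: ifP => [/hE[]|] //; rewrite sub0set.
  - by move=> x xN; rewrite xN; case: (hE x xN).
  move=> n m nN mN; have [m0|m0] := eqVneq m 0.
    have [z nE] := rad_rgen t0 nN; exists z; rewrite m0 mul0r addr0 nE.
    rewrite (radMr _ tN); case: (hE _ (radMr z tN)) => /subsetP-> //.
    by rewrite !inE eqxx orbT.
  have [z nE] := rad_rgen m0 (radN nN); exists z; rewrite -nE subrr.
  rewrite (radMr _ tN); case: (hE _ (radMr z tN)) => /subsetP-> //.
  by rewrite !inE eqxx.
exists (fun x => if x == 0 then N else [set 0]); split.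
- by move=> x; case: ifP => _; rewrite ?sub1set ?rad0.
- by move=> x xN; case: ifP => _; rewrite ?N2 ?cards1.
- by move=> n m nN mN; exists 0; rewrite !mulr0 eqxx addr0.
Qed.

(** Left multiplication by [t] has kernel [N], so [t * p.2] encodes the class of [p.2] modulo [N].
    Each element of [E (t * p.2)] thus removes a segment of [#|N|] points. *)
Definition unblocked (E : R -> {set R}) : {set R * R} :=
  [set p | (p.1 \in N) && (p.1 \notin E (t * p.2))].

Lemma card_unblocked_slice k E (z : R) : blocking_family k E ->
  (#|[set n in N | n \notin E (t * z)%R]| + k + (z \in N) = #|N|)%N.
Proof.
case=> EN cardE _; have tzN := radMr z tN.
rewrite -(mull_unif_eq0 tN t0) -addnA -cardE //.
rewrite -(cardsID (E (t * z)) N) (setIidPr (EN _)) addnC; congr (_ + _)%N.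
by apply: eq_card => n; rewrite !inE andbC.
Qed.

Lemma card_unblocked k E : blocking_family k E ->
  (#|unblocked E| + #|N| ^ 2 * k + #|N| = #|N| ^ 3)%N.
Proof.
move=> famE; rewrite card_sum_snd.
have -> : (#|N| ^ 2 * k = \sum_(z : R) k)%N.
  by rewrite sum_nat_const cardT -cardE card_chain_ring.
have {1}-> : #|N| = (\sum_(z : R) (z \in N))%N.
  by rewrite -sum1_card big_mkcond; apply: eq_bigr => z _; case: (_ \in N).
rewrite -!big_split /= expnSr -mulnn -card_chain_ring -sum_nat_const.
apply: eq_bigr => z _; rewrite -(card_unblocked_slice z famE).
by congr (_ + _ + _)%N; apply: eq_card => n; rewrite !inE.
Qed.

(** In the chart such a line has one point for each [z] in [R], and the family blocks at least one
    of them. *)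
Lemma card_unblocked_line k E (c e : R) : blocking_family k E ->
    c \in N -> e \in N ->
  (#|[set z | (c + e * z, z)%R \in unblocked E]| <= #|N| ^ 2 - 1)%N.
Proof.
case=> _ _ block cN eN; have [z zE] := block _ _ cN eN.
rewrite -mulnn -card_chain_ring -cardsT (cardsD1 z setT) inE add1n subn1 /=.
apply/subset_leq_card/subsetP => z'; rewrite !inE andbT => /andP[_].
by apply: contraNneq => ->.
Qed.

(* In the three charts, the arc is given by U and unblocked Eb, by unblocked Ea,
   and by no point at all. *)
Lemma triangle_arc a b Ea Eb :
    blocking_family a Ea -> blocking_family b Eb -> (a + b = #|N|)%N ->
  exists K : {set {set vec R}},
    proj_arc K (#|N| ^ 4 - #|N| ^ 2 - #|N|) (#|N| ^ 2 - 1).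
Proof.
move=> famA famB abq; have q1 := card_rad_gt1.
have qle : (#|N| <= #|N| ^ 2)%N by rewrite -mulnn leq_pmulr // ltnW.
have qq : #|R| = (#|N| ^ 2)%N by rewrite card_chain_ring mulnn.
(* In the classes with [y] outside [N], only the points of Z = 0 are left out: this side has
   multiplicity 1 and its points need not be moved there. *)
pose U := setX (~: N) (~: [set (0 : R)]).
pose A1 := U :|: unblocked Eb.
have cardU : #|U| = ((#|N| ^ 2 - #|N|) * (#|N| ^ 2 - 1))%N.
  by rewrite cardsX [#|~: N|]cardsCs [#|~: [set _]|]cardsCs !setCK cards1 qq.
have cardA1 : #|A1| = (#|U| + #|unblocked Eb|)%N.
  rewrite cardsU [_ :&: _](_ : _ = set0) ?cards0 ?subn0 //.
  apply/setP => -[y z]; rewrite !inE /=.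
  by case: (y \in N); rewrite ?andbF.
have -> : (#|N| ^ 4 - #|N| ^ 2 - #|N| = #|A1| + #|unblocked Ea| + #|(set0 : {set R * R})|)%N.
  rewrite cards0 addn0 cardA1 cardU; move: (card_unblocked famA).
  by move: (card_unblocked famB); apply: triangle_arc_size; rewrite // addnC.
have A3_0 (f : R -> R * R) : #|[set x | f x \in (set0 : {set R * R})]| = 0%N.
  by apply: eq_card0 => x; rewrite !inE.
apply: proj_arc_of_charts.
- by move=> p; rewrite inE => /andP[].
- by move=> p; rewrite inE.
- move=> c d.
  have sliceA : (#|[set x | (x, c * x + d)%R \in unblocked Ea]| + a + (d \in N)
                 = #|N|)%N.
    rewrite -(card_unblocked_slice d famA); congr (_ + _ + _)%N.
    apply: eq_card => n; rewrite !inE /=; apply: andb_id2l => nN.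
    by rewrite mulrDr mulrA (rad_mul0 (radMr c tN) nN) add0r.
  have sliceB : (#|[set y | (y, c + d * y)%R \in unblocked Eb]| + b + (c \in N)
                 = #|N|)%N.
    rewrite -(card_unblocked_slice c famB); congr (_ + _ + _)%N.
    apply: eq_card => n; rewrite !inE /=; apply: andb_id2l => nN.
    by rewrite mulrDr mulrA (rad_mul0 (radMr d tN) nN) addr0.
  pose S := [set y | (y, c + d * y) \in U].
  have leU : (#|[set y | (y, c + d * y)%R \in A1]| <=
      #|S| + #|[set y | (y, c + d * y)%R \in unblocked Eb]|)%N.
    apply: leq_trans (leq_card_setU _ _); apply/subset_leq_card/subsetP => y.
    by rewrite !inE.
  have cardCN : #|~: N| = (#|N| ^ 2 - #|N|)%N by rewrite cardsCs setCK qq.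
  have subS : S \subset ~: N by apply/subsetP => y; rewrite !inE => /andP[].
  have leS : (#|S| <= #|N| ^ 2 - #|N|)%N by rewrite -cardCN subset_leq_card.
  apply: leq_trans (leq_add leU (leqnn _)) _.
  move: sliceA sliceB; move: #|[set x | _]| #|[set x | _]| => sA sB sliceA sliceB.
  (* As [a + b = #|N|], the bounds add up to [#|N| ^ 2], less one for each of [c] and [d] that lies
     in [N]. If neither does, the line meets Z = 0 where [y = u * - c], which is outside [N], and
     [S] loses that value. *)
  have [cN|cN] := boolP (c \in N).
    by rewrite cN in sliceB; lia.
  have [dN|dN] := boolP (d \in N).
    by rewrite dN in sliceA; lia.
  have [u du] := rinv_notin_rad dN.
  have uN : u * - c \notin N.
    rewrite radM negb_or; apply/andP; split.
      by apply: contra one_notin_rad; rewrite -du => /radMl->.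
    by apply: contra cN => /radN; rewrite opprK.
  have ltS : (#|S| < #|~: N|)%N.
    apply/proper_card/properP; split=> //; exists (u * - c); rewrite inE //.
    by rewrite !inE negb_and !negbK mulrA du mul1r subrr eqxx orbT.
  rewrite cardCN in ltS; rewrite (negPf dN) in sliceA; rewrite (negPf cN) in sliceB.
  by lia.
(* If [c] is in [N], the line neighbours Y = 0 and is blocked by [Eb]; otherwise its point with
   [z = 0] is missing from [U]. *)
- move=> c e eN; rewrite A3_0 addn0; have [cN|cN] := boolP (c \in N).
    apply: leq_trans (card_unblocked_line famB cN eN).
    apply/subset_leq_card/subsetP => z; rewrite !inE /=.
    by rewrite radD ?radMr.
  rewrite -qq -cardsT (cardsD1 0 setT) inE add1n subn1 /=.
  apply/subset_leq_card/subsetP => z; rewrite !inE /= andbT.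
  by rewrite radDr ?radMr // (negPf cN) /= orbF.
- move=> c e cN eN; rewrite A3_0 addn0.
  exact: card_unblocked_line famA cN eN.
Qed.

End Triangle.

(** * The arc from a quadrilateral *)

Section OrderNine.
Hypothesis N3 : #|N| = 3%N.

(** Translation by [n] permutes the three elements of [N], yet adds [n *+ 3] to their sum. *)
Lemma rad_mulr3n n : n \in N -> n *+ 3 = 0.
Proof.
move=> nN; have: \sum_(m in N) m = \sum_(m in N) (n + m).
  rewrite [LHS](reindex_inj (addrI n)) /=.
  by apply: eq_bigl => m; rewrite radDl.
by rewrite big_split /= sumr_const N3 -[LHS]add0r => /addIr <-.
Qed.

Lemma rad_nat3 : 3%:R \in N.
Proof.
have [t tN t0] := rad_nonzero.
by rewrite -(mulr_unif_eq0 tN t0) mulr_natl rad_mulr3n.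
Qed.

Lemma nat2_notin_rad : 2%:R \notin N.
Proof.
apply: contra one_notin_rad => N2; rewrite -(radDl _ N2).
by have := rad_nat3; rewrite -natr1.
Qed.

(** This is reduction modulo [N], with values in ['Z_3] so that conditions on residues can be
    settled by enumeration. *)
Definition residue (x : R) : 'Z_3 :=
  if x \in N then 0 else if x - 1 \in N then 1 else -1.

(** Outside the classes of 0 and 1, [x * t] is an element of [N], whose elements are 0, [t] and
    [- t], but it is neither 0 nor [t]; so [x + 1] is in [N]. As a natural number, [-1] in ['Z_3] is
    2, and [rad_nat3] bridges the difference. *)
Lemma residueP x : x - (residue x)%:R \in N.
Proof.
rewrite /residue; case: ifP => [xN|xN]; first by rewrite subr0.
case: ifP => [//|x1N].
have [t tN t0] := rad_nonzero.
have x_t : x * t \in [set 0; t; - t].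
  suff <- : N = [set 0; t; - t] by rewrite radMl.
  apply/esym/eqP; rewrite eqEcard; apply/andP; split.
    by rewrite !subUset !sub1set rad0 tN radN.
  have tt : t != - t.
    rewrite -subr_eq0 opprK -mulr2n -mulr_natl (mulr_unif_eq0 tN t0).
    exact: nat2_notin_rad.
  rewrite N3 cardsU cards1 cards2 (eq_sym 0) t0 /=.
  rewrite (_ : _ :&: _ = set0) ?cards0 //.
  apply/setP => y; rewrite !inE; apply/negP => /andP[+ /eqP yE].
  by rewrite yE oppr_eq0 (negPf t0) eq_sym (negPf tt).
have e1 : (x * t == t) = (x - 1 \in N).
  by rewrite -(mulr_unif_eq0 tN t0) mulrBl mul1r subr_eq0.
have e2 : (x * t == - t) = (x + 1 \in N).
  by rewrite -(mulr_unif_eq0 tN t0) mulrDl mul1r addr_eq0.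
move: x_t; rewrite !inE (mulr_unif_eq0 tN t0) xN e1 x1N e2 /= => xN1.
suff <- : (x + 1) - 3%:R = x - 2%:R by rewrite radB ?rad_nat3.
have -> : 3%:R = 2%:R + 1 :> R by rewrite natr1.
by rewrite opprD addrACA subrr addr0.
Qed.

Lemma natr_rad_inj (i j : 'Z_3) : i%:R - j%:R \in N -> i = j.
Proof.
have N1 := negPf one_notin_rad; have N2 := negPf nat2_notin_rad.
have radNE (x : R) : (- x \in N) = (x \in N).
  by apply/idP/idP => /radN //; rewrite opprK.
case: i j => [[|[|[|//]]] ?] [[|[|[|//]]] ?] /=;
  rewrite ?subrr ?subr0 ?sub0r ?radNE ?N1 ?N2 // => h; apply: val_inj => //=.
- by move: h; rewrite -opprB radNE -natrB //= N1.
- by move: h; rewrite -natrB //= N1.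
Qed.

(** [k] may exceed 2, so that sums and products of representatives can be used directly; reducing it
    changes [k%:R] by a multiple of 3, which is in [N]. *)
Lemma residue_uniq (x : R) (k : nat) : x - k%:R \in N -> residue x = k%:R.
Proof.
move=> xk; apply: natr_rad_inj; rewrite val_Zp_nat //.
set r : R := (residue x)%:R; set m := (k %% 3)%N.
suff -> : r - m%:R = (x - k%:R) - (x - r) + (k %/ 3)%:R * 3%:R.
  by apply: radD (radB xk (residueP x)) (radMl _ rad_nat3).
rewrite opprB [_ + (r - x)]addrC subrKA {1}(divn_eq k 3) addnC natrD natrM.
by rewrite opprD addrA subrK.
Qed.

Lemma residue_eq0 x : (residue x == 0) = (x \in N).
Proof. by rewrite /residue; case: ifP => // _; case: ifP. Qed.

Lemma residueD x y : residue (x + y) = residue x + residue y.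
Proof.
rewrite (@residue_uniq _ (residue x + residue y)); last first.
  by rewrite natrD opprD addrACA radD ?residueP.
by rewrite natrD !natr_Zp.
Qed.

Lemma residueM x y : residue (x * y) = residue x * residue y.
Proof.
rewrite (@residue_uniq _ (residue x * residue y)); last first.
  rewrite natrM -(subrKA (x * (residue y)%:R)) -mulrBr -mulrBl.
  exact: radD (radMl x (residueP y)) (radMr _ (residueP x)).
by rewrite natrM !natr_Zp.
Qed.

Lemma residue1 : residue 1 = 1.
Proof. by rewrite (@residue_uniq _ 1) ?subrr ?rad0. Qed.

Lemma rad_mul_residue e z : e \in N -> e * z = e *+ residue z.
Proof.
move=> eN; rewrite -mulr_natr; apply/eqP.
by rewrite -subr_eq0 -mulrBr (rad_mul0 eN (residueP z)).
Qed.

Definition class_count (i : 'Z_3) (P : pred R) :=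
  #|[set y | (residue y == i) && P y]|.

Lemma card_class_count (P : pred R) :
  #|[set y | P y]| = (class_count 0%R P + class_count 1%R P + class_count (-1)%R P)%N.
Proof.
rewrite -sum1dep_card (partition_big residue predT) //= !big_ord_recl big_ord0.
by rewrite addn0 addnA; congr (_ + _ + _)%N; rewrite sum1dep_card;
   apply: eq_card => y; rewrite !inE andbC.
Qed.

Lemma class_count_const i (P : pred R) (b : bool) :
  (forall y, residue y = i -> P y = b) -> class_count i P = (3 * b)%N.
Proof.
move=> PE; have -> : class_count i P = #|[set y | (residue y == i) && b]|.
  by apply: eq_card => y; rewrite !inE; apply: andb_id2l => /eqP/PE.
case: b {PE}; last by apply: eq_card0 => y; rewrite !inE andbF.
transitivity #|[set i%:R + n | n in N]|; last first.
  by rewrite (card_imset _ (@addrI _ _)) N3.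
apply: eq_card => y.
rewrite !inE andbT; apply/eqP/imsetP => [<-|[n nN ->]].
  by exists (y - (residue y)%:R); rewrite ?residueP // addrC subrK.
by rewrite (@residue_uniq _ i) ?natr_Zp // addrC addKr.
Qed.

Lemma class_countC i P : (class_count i P + class_count i (predC P) = 3)%N.
Proof.
rewrite -[RHS]/(3 * true)%N -(@class_count_const i predT true) //.
rewrite /class_count -[RHS](cardsID [set y | P y]); congr (_ + _)%N;
  by apply: eq_card => y; rewrite !inE /= andbT // andbC.
Qed.

Lemma class_count_le3 i P : (class_count i P <= 3)%N.
Proof. by rewrite -(class_countC i P) leq_addr. Qed.

(** The slope [d] is a unit, so [u * - g] is the only root, and the condition on residues places it
    in class [i]. *)
Lemma class_count_root i (P : pred R) g d :
    residue d != 0 -> residue g + residue d * i = 0 ->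
    (forall y, residue y = i -> P y = (g + d * y == 0)) ->
  class_count i P = 1%N.
Proof.
rewrite residue_eq0 => dN gd PE; have [u du] := rinv_notin_rad dN.
rewrite -(cards1 (u * - g)); apply: eq_card => y; rewrite !inE.
have rootE : (g + d * y == 0) = (y == u * - g).
  rewrite addrC addr_eq0; apply/eqP/eqP => [|->]; last by rewrite mulrA du mul1r.
  by move=> E; apply: (mulr_notin_rad_inj dN); rewrite E mulrA du mul1r.
apply/andP/idP => [[/eqP/PE->]|]; rewrite -rootE // => /eqP root.
suff ri : residue y = i by rewrite ri PE ?root ?eqxx.
have /eqP: residue (g + d * y) = 0 by apply/eqP; rewrite residue_eq0 root rad0.
rewrite residueD residueM -gd => /eqP/addrI.
move: dN; rewrite -residue_eq0; move: (residue d) (residue y) i {PE gd root}.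
by case=> [[|[|[|//]]] ?] [[|[|[|//]]] ?] [[|[|[|//]]] ?] // _ /(congr1 val) //= _;
   apply: val_inj.
Qed.

Lemma class_count_nonroot i (P : pred R) g d :
    residue d != 0 -> residue g + residue d * i = 0 ->
    (forall y, residue y = i -> P y = (g + d * y != 0)) ->
  class_count i P = 2%N.
Proof.
move=> d0 gd PE; have := class_countC i P.
rewrite (@class_count_root i (predC P) g d) // => [|y yi]; first by lia.
by rewrite /= PE ?negbK.
Qed.

(* [quad1], [quad2], [quad3] describe the points (1 : y : z), (x : 1 : z),
   (x : y : 1) of the arc; in [quad1] the residues of (y, z) tell the vertices
   and the other points of the quadrilateral apart. *)
Definition quad1 (y z : R) :=
  if residue y == 0 then
    if residue z == 0 then z == 0 else if residue z == 1 then y != 0 else y == 0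
  else if residue y == 1 then
    if residue z == 0 then z != 0
    else if residue z == 1 then 1 + y + z != 0 else true
  else if residue z == 0 then 1 + y + z == 0 else true.

Definition quad2 (x z : R) :=
  (residue x == 0) && if residue z == 1 then x != 0 else x == 0.

Definition quad3 (x y : R) := (residue x == 0) && (y == 0).

Lemma sum_residue (f : 'Z_3 -> nat) :
  (\sum_(y : R) f (residue y) = 3 * f 0%R + 3 * f 1%R + 3 * f (-1)%R)%N.
Proof.
rewrite (partition_big residue predT) //= !big_ord_recl big_ord0 addn0 addnA.
have slice (i : 'Z_3) : (\sum_(y | residue y == i) f (residue y) = 3 * f i)%N.
  rewrite (eq_bigr (fun=> f i)) => [|y /eqP-> //].
  rewrite sum_nat_cond_const; congr (_ * _)%N.
  rewrite -[RHS](@class_count_const i predT true) //.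
  by apply: eq_card => y; rewrite !inE andbT.
by rewrite -3!slice.
Qed.

Lemma card_quad1 : #|[set p : R * R | quad1 p.1 p.2]| = 54%N.
Proof.
rewrite card_sum_fst.
(* Over the classes of [z], 4 is 1 + 3 + 0 or 1 + 0 + 3; 7 is 2 + 2 + 3 for residue 1 and 1 + 3 + 3
   for residue -1. *)
rewrite (eq_bigr (fun y => if residue y == 0%R then 4 else 7)%N); last first.
  move=> y _; transitivity #|[set z | quad1 y z]|.
    by apply: eq_card => z; rewrite !inE.
  rewrite card_class_count /quad1; have [y0|y0] := eqVneq (residue y) 0.
    rewrite (@class_count_root 0 _ 0 1); first last.
    - by move=> z ->; rewrite add0r mul1r.
    - by rewrite mulr0 addr0; apply/eqP; rewrite residue_eq0 rad0.
    - by rewrite residue1.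
    rewrite (@class_count_const 1 _ (y != 0)) => [|z -> //].
    rewrite (@class_count_const (-1) _ (y == 0)) => [|z -> //].
    by case: (y == 0).
  have [y1|y1] := eqVneq (residue y) 1.
    rewrite (@class_count_nonroot 0 _ 0 1); first last.
    - by move=> z ->; rewrite add0r mul1r.
    - by rewrite mulr0 addr0; apply/eqP; rewrite residue_eq0 rad0.
    - by rewrite residue1.
    rewrite (@class_count_nonroot 1 _ (1 + y) 1); first last.
    - by move=> z ->; rewrite mul1r.
    - by rewrite residueD y1 residue1; apply: val_inj.
    - by rewrite residue1.
    by rewrite (@class_count_const (-1) _ true) => [|z -> //].
  have y2 : residue y = -1.
    by move: (residue y) y0 y1 => [[|[|[|//]]] ?] // _ _; apply: val_inj.
  rewrite (@class_count_root 0 _ (1 + y) 1); first last.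
  - by move=> z ->; rewrite mul1r.
  - by rewrite residueD y2 residue1; apply: val_inj.
  - by rewrite residue1.
  rewrite (@class_count_const 1 _ true) => [|z -> //].
  by rewrite (@class_count_const (-1) _ true) => [|z -> //].
by rewrite (sum_residue (fun i => if i == 0%R then 4 else 7)%N).
Qed.

(** This serves both the lines [x |-> c * x + d] and, with constant [f], the count of [quad2]. *)
Lemma card_quad2_line d (f : R -> R) :
    (forall x, x \in N -> residue (f x) = residue d) ->
  #|[set x | quad2 x (f x)]| = (if residue d == 1%R then 2 else 1)%N.
Proof.
move=> fE; transitivity (class_count 0 (fun x => if residue d == 1 then x != 0 else x == 0)).
  apply: eq_card => x; rewrite !inE /quad2; apply: andb_id2l.
  by rewrite residue_eq0 => /fE->.
case: ifP => _; [apply: (@class_count_nonroot 0 _ 0 1)|apply: (@class_count_root 0 _ 0 1)].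
all: rewrite ?residue1 ?mulr0 ?addr0 //.
all: by [apply/eqP; rewrite residue_eq0 rad0 | move=> y _; rewrite add0r mul1r].
Qed.

Lemma card_quad2 : #|[set p : R * R | quad2 p.1 p.2]| = 12%N.
Proof.
rewrite card_sum_snd.
rewrite (eq_bigr (fun z => if residue z == 1%R then 2 else 1)%N); last first.
  move=> z _; rewrite -(card_quad2_line (f := fun=> z)) //.
  by apply: eq_card => x; rewrite !inE.
by rewrite (sum_residue (fun i => if i == 1%R then 2 else 1)%N).
Qed.

Lemma card_quad3 : #|[set p : R * R | quad3 p.1 p.2]| = 3%N.
Proof.
transitivity #|setX N [set (0 : R)]|; last by rewrite cardsX cards1 N3.
by apply: eq_card => -[x y]; rewrite !inE /= -residue_eq0.
Qed.

Lemma quad_line1 c d :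
  (#|[set y | quad1 y (c + d * y)%R]| + #|[set x | quad2 x (c * x + d)%R]| <= 8)%N.
Proof.
rewrite (card_quad2_line (d := d)) => [|x]; last first.
  by rewrite -residue_eq0 residueD residueM => /eqP->; rewrite mulr0 add0r.
set P := fun y => quad1 y (c + d * y).
have resE y i : residue y = i -> residue (c + d * y) = residue c + residue d * i.
  by move=> <-; rewrite residueD residueM.
have res0 : residue 0 = 0 by apply/eqP; rewrite residue_eq0 rad0.
(* These bounds for the classes of [y] depend only on the residues of [c] and [d], which leaves nine
   cases to compute. The value is 3 if the class is unrestricted or the restricting affine function
   has slope in [N]; otherwise it is 1 for an equation and 2 for an inequation. *)
pose b0 := if residue c == 0 then if residue d == 0 then 3%N else 1%N
           else if residue c == 1 then 2%N else 1%N.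
pose b1 := if residue c + residue d == 0 then if residue d == 0 then 3%N else 2%N
           else if residue c + residue d == 1 then
             if 1 + residue d == 0 then 3%N else 2%N
           else 3%N.
pose b2 := if residue c - residue d == 0 then
             if 1 + residue d == 0 then 3%N else 1%N
           else 3%N.
have bound0 : (class_count 0%R P <= b0)%N.
  rewrite /b0.
  have PE y : residue y = 0 -> P y = if residue c == 0 then c + d * y == 0
      else if residue c == 1 then y != 0 else y == 0.
    by move=> y0; rewrite /P /quad1 (resE _ _ y0) y0 mulr0 addr0.
  case: eqP PE => [c0|_] PE.
    case: eqP => [_|/eqP d0]; first exact: class_count_le3.
    by rewrite (@class_count_root 0 _ c d) // c0 mulr0 addr0.
  case: eqP PE => _ PE.
    rewrite (@class_count_nonroot 0 _ 0 1) ?residue1 ?mulr0 ?addr0 // => y /PE->.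
    by rewrite add0r mul1r.
  rewrite (@class_count_root 0 _ 0 1) ?residue1 ?mulr0 ?addr0 // => y /PE->.
  by rewrite add0r mul1r.
have sumE y : 1 + y + (c + d * y) = (1 + c) + (1 + d) * y.
  by rewrite mulrDl mul1r addrACA.
have bound1 : (class_count 1%R P <= b1)%N.
  rewrite /b1.
  have PE y : residue y = 1 ->
      P y = if residue c + residue d == 0 then c + d * y != 0
            else if residue c + residue d == 1 then 1 + c + (1 + d) * y != 0
            else true.
    by move=> y1; rewrite /P /quad1 (resE _ _ y1) y1 mulr1 sumE.
  case: eqP PE => [cd0|_] PE.
    case: eqP => [_|/eqP d0]; first exact: class_count_le3.
    by rewrite (@class_count_nonroot 1 _ c d) // mulr1.
  case: eqP PE => [cd1|_] PE; last exact: class_count_le3.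
  case: eqP => [_|/eqP d0]; first exact: class_count_le3.
  rewrite (@class_count_nonroot 1 _ (1 + c) (1 + d)) ?residueD ?residue1 //.
  by rewrite mulr1 addrACA cd1; apply: val_inj.
have bound2 : (class_count (-1)%R P <= b2)%N.
  rewrite /b2.
  have PE y : residue y = -1 ->
      P y = if residue c - residue d == 0 then 1 + c + (1 + d) * y == 0 else true.
    by move=> y2; rewrite /P /quad1 (resE _ _ y2) y2 mulrN1 sumE.
  case: eqP PE => [cd0|_] PE; last exact: class_count_le3.
  case: eqP => [_|/eqP d0]; first exact: class_count_le3.
  rewrite (@class_count_root (-1) _ (1 + c) (1 + d)) ?residueD ?residue1 //.
  by rewrite mulrN1 opprD addrACA subrr add0r.
rewrite card_class_count; apply: leq_trans (leq_add (leq_add (leq_add bound0 bound1) bound2) (leqnn _)) _.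
by rewrite /b0 /b1 /b2; move: (residue c) (residue d);
   move=> [[|[|[|//]]] ?] [[|[|[|//]]] ?].
Qed.

Lemma quad_line2 c e : e \in N ->
  (#|[set z | quad1 (c + e * z)%R z]| + #|[set x | quad3 x (c * x + e)%R]| <= 8)%N.
Proof.
pose P (z : R) := quad1 (c + e * z) z.
move=> eN; rewrite [X in (X + _ <= _)%N](card_class_count P).
have res0 : residue 0 = 0 by apply/eqP; rewrite residue_eq0 rad0.
have e0 : residue e = 0 by apply/eqP; rewrite residue_eq0.
have resE z : residue (c + e * z) = residue c.
  by rewrite residueD residueM e0 mul0r addr0.
have sumE z : 1 + (c + e * z) + z = (1 + c) + (e + 1) * z.
  by rewrite mulrDl mul1r !addrA.
rewrite [X in (_ + X <= _)%N](_ : _ = class_count 0 (fun x => e + c * x == 0));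
  last by apply: eq_card => x; rewrite !inE addrC.
have [c0|c0] := eqVneq (residue c) 0.
  have cN : c \in N by rewrite -residue_eq0 c0.
  rewrite (@class_count_root 0 P 0 1); first last.
  - by move=> z z0; rewrite /P /quad1 resE c0 z0 add0r mul1r.
  - by rewrite mulr0 addr0.
  - by rewrite residue1.
  rewrite (@class_count_const 1 P (c + e != 0)); last first.
    by move=> z z1; rewrite /P /quad1 resE c0 z1 (rad_mul_residue _ eN) z1.
  rewrite (@class_count_const (-1) P (c + e *+ 2 == 0)); last first.
    by move=> z z1; rewrite /P /quad1 resE c0 z1 (rad_mul_residue _ eN) z1.
  rewrite (@class_count_const 0 _ (e == 0)); last first.
    by move=> x /eqP; rewrite residue_eq0 => xN; rewrite (rad_mul0 cN xN) addr0.
  (* The total is 1, plus 3 for each of [c + e != 0], [c + e *+ 2 == 0], [e == 0]; not all three can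
     hold. *)
  have [->|_] := eqVneq e 0; first by rewrite mul0rn addr0; case: (c == 0).
  by case: (_ != _); case: (_ == _).
have root0 : class_count 0 (fun x => e + c * x == 0) = 1%N.
  by apply: (@class_count_root 0 _ e c); rewrite // mulr0 addr0.
have [c1|c1] := eqVneq (residue c) 1.
  rewrite (@class_count_nonroot 0 P 0 1); first last.
  - by move=> z z0; rewrite /P /quad1 resE c1 z0 add0r mul1r.
  - by rewrite mulr0 addr0.
  - by rewrite residue1.
  rewrite (@class_count_nonroot 1 P (1 + c) (e + 1)); first last.
  - by move=> z z1; rewrite /P /quad1 resE c1 z1 sumE.
  - by rewrite !residueD residue1 c1 e0; apply: val_inj.
  - by rewrite residueD residue1 e0.
  by rewrite root0 -addnA addn1; have := class_count_le3 (-1) P; lia.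
have c2 : residue c = -1.
  by move: (residue c) c0 c1 => [[|[|[|//]]] ?] // _ _; apply: val_inj.
rewrite (@class_count_root 0 P (1 + c) (e + 1)); first last.
- by move=> z z0; rewrite /P /quad1 resE c2 z0 sumE.
- by rewrite !residueD residue1 c2 e0; apply: val_inj.
- by rewrite residueD residue1 e0.
by rewrite root0; have := class_count_le3 1 P; have := class_count_le3 (-1) P; lia.
Qed.

Lemma quad_line3 c e : c \in N -> e \in N ->
  (#|[set z | quad2 (c + e * z)%R z]| + #|[set y | quad3 (c * y + e)%R y]| <= 8)%N.
Proof.
pose P (z : R) := quad2 (c + e * z) z.
move=> cN eN; rewrite [X in (X + _ <= _)%N](card_class_count P).
have resE z : (residue (c + e * z) == 0) by rewrite residue_eq0 radD ?radMr.
have const (i : 'Z_3) (b : bool) : (if i == 1 then c + e *+ i != 0 else c + e *+ i == 0) = b ->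
    class_count i P = (3 * b)%N.
  move=> bE; apply: class_count_const => z zi.
  by rewrite /P /quad2 resE zi (rad_mul_residue _ eN) zi.
have y_le1 : (#|[set y | quad3 (c * y + e)%R y]| <= 1)%N.
  rewrite -(cards1 (0 : R)); apply/subset_leq_card/subsetP => y.
  by rewrite !inE => /andP[].
apply: leq_trans (leq_add (leqnn _) y_le1) _.
rewrite (const 0 (c == 0)) ?addr0 //= (const 1 (c + e != 0)) //.
rewrite (const (-1) (c + e *+ 2 == 0)) //.
(* Not all of [c == 0], [c + e != 0], [c + e *+ 2 == 0] hold, because [e *+ 2 = - e]; so the total
   is at most 3 + 3 + 1. *)
have [->|_] := eqVneq c 0; last by case: (_ != _); case: (_ == _).
have /eqP := rad_mulr3n eN; rewrite mulrS addrC addr_eq0 => /eqP->.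
by rewrite !add0r oppr_eq0; case: (e == 0).
Qed.

Lemma quadrilateral_arc : exists K : {set {set vec R}}, proj_arc K 69 8.
Proof.
have -> : 69%N = (#|[set p : R * R | quad1 p.1 p.2]| +
  #|[set p : R * R | quad2 p.1 p.2]| + #|[set p : R * R | quad3 p.1 p.2]|)%N.
  by rewrite card_quad1 card_quad2 card_quad3.
apply: proj_arc_of_charts.
- by move=> p; rewrite inE -residue_eq0 => /andP[].
- by move=> p; rewrite inE -residue_eq0 => /andP[-> /eqP->]; rewrite rad0.
- move=> c d; apply: leq_trans (quad_line1 c d).
  by apply: leq_add; apply/subset_leq_card/subsetP => y; rewrite !inE.
- move=> c e eN; apply: leq_trans (quad_line2 c eN).
  by apply: leq_add; apply/subset_leq_card/subsetP => y; rewrite !inE.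
- move=> c e cN eN; apply: leq_trans (quad_line3 cN eN).
  by apply: leq_add; apply/subset_leq_card/subsetP => y; rewrite !inE.
Qed.

End OrderNine.

End ChainRing.

(** * Choice of the construction *)

Theorem theorem3p1 (R : finNzRingType) (N : {set R}) (q : nat) :
  chain_ring2 N -> #|R| = (q * #|N|)%N ->
  exists K : {set {set vec R}}, proj_arc K (q ^ 4 - q ^ 2 - q) (q ^ 2 - 1).
Proof.
move=> chN cardR; have N_gt1 := card_rad_gt1 chN.
have -> : q = #|N|.
  apply/eqP; rewrite -(eqn_pmul2r (ltnW N_gt1)) -cardR.
  by apply/eqP/card_chain_ring.
(* For order 3, no [a + b = 3] has both parts within reach of [blocking_family_exists]. *)
have [N3|N3] := eqVneq #|N| 3.
  by rewrite N3; apply: quadrilateral_arc chN N3.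
have [t tN t0] := rad_nonzero chN.
(* The multiplicities are 1, 1 for order 2; from order 4 on they are 2 and [#|N| - 2], both strictly
   between 1 and [#|N|]. *)
pose a := if #|N| == 2 then 1 else 2.
have [|Ea famA] := blocking_family_exists chN tN t0 (k := a).
  by rewrite /a; case: eqP => ?; [right | left; lia].
have [|Eb famB] := blocking_family_exists chN tN t0 (k := #|N| - a).
  by rewrite /a; case: eqP => [->|?]; [right | left; lia].
apply: (triangle_arc chN tN t0 famA famB).
by rewrite subnKC // /a; case: eqP => ?; lia.
Qed.
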